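(* Let $X$ be a proper, uniquely geodesic, straight metric space, $b\in X$ a basepoint and $B:\overline{X}^v_b\to\overline{X}^h$ the corresponding Busemann map. Let $\gamma$ be a geodesic ray based at $b$. Then the following three statements are equivalent: (1) The Busemann map $B$ restricted to the boundary $D_b$ is continuous at $\gamma$. (2) The fiber $\Pi^{-1}(\gamma)$ is a singleton. (3) The Busemann map $B$ is continuous at $\gamma$.
   Context: A geodesic in a metric space $(X,d)$ is a map $\gamma:I\to X$ from an interval $I\subset\mathbb{R}$ with $d(\gamma(t),\gamma(s))=|t-s|$. $X$ is proper if closed balls are compact; uniquely geodesic if any two distinct points are joined by a unique geodesic; straight if every geodesic segment is contained in a unique bi-infinite geodesic. Visual compactification based at $b$: let $D_b$ be the set of geodesic rays $\gamma:[0,\infty)\to X$ with $\gamma(0)=b$, with the topology of uniform convergence on compact sets. The map $(\theta,r)\mapsto\theta(r)$ is a homeomorphism $D_b\times[0,\infty)/(D_b\times\{0\})\to X$; $\overline{X}^v_b=X\cup D_b$ is given the topology of $D_b\times[0,\infty]/(D_b\times\{0\})$, with $D_b\times\{\infty\}$ identified with $D_b$, the boundary. Horofunction compactification: $h:X\to C(X)$, $h(x)(\cdot)=d(x,\cdot)-d(x,b)$, where $C(X)$ has the topology of uniform convergence on compact sets; $h$ is an embedding, $\overline{X}^h=\overline{h(X)}$ is compact, and $\partial\overline{X}^h=\overline{X}^h\setminus h(X)$. Busemann map: $B(x)=h(x)$ for $x\in X$ and $B(\gamma)=\lim_{t\to\infty}h(\gamma(t))$ (which exists) for $\gamma\in D_b$.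 The map $\Pi:\overline{X}^h\to\overline{X}^v_b$ is defined by $\Pi(h(x))=x$ for $x\in X$ and, for $\xi\in\partial\overline{X}^h$, $\Pi(\xi)$ is the unique geodesic ray $\gamma$ starting at $b$ whose bi-infinite extension satisfies $\xi(\gamma(t))-\xi(\gamma(0))=-t$ for all $t\in\mathbb{R}$. (Equivalently, $\Pi$ is the unique continuous map with $\Pi\circ h$ equal to the inclusion $X\hookrightarrow\overline{X}^v_b$.) *)

(* Defs.v *)
From HB Require Import structures.
From mathcomp Require Import all_boot all_order all_algebra.
From mathcomp Require Import all_classical all_reals all_analysis.

Set Implicit Arguments.
Unset Strict Implicit.
Unset Printing Implicit Defensive.

Import Order.TTheory GRing.Theory Num.Theory.
Import numFieldNormedType.Exports.

Local Open Scope classical_set_scope.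
Local Open Scope ring_scope.

Section geodesics.
Context {R : realType} {X : metricType R}.

Definition proper_space : Prop :=
  forall (x : X) (r : R), compact [set y | mdist x y <= r].

(* [I] is coerced to the subtype of its elements; it is always instantiated
   with an interval *)
Definition geodesic (I : set R) (g : I -> X) : Prop :=
  forall s t : I, mdist (g s) (g t) = `|val t - val s|.

Definition geodesic_line (g : R -> X) : Prop :=
  forall s t : R, mdist (g s) (g t) = `|t - s|.

Definition joins (x y : X) (g : `[0, mdist x y]%classic -> X) : Prop :=
  (forall t, val t = 0 -> g t = x) /\ (forall t, val t = mdist x y -> g t = y).

(* A geodesic joining two points is normalised to have domain [0, d(x, y)],
   without which it would only be unique up to translation of the interval. *)
Definition uniquely_geodesic : Prop :=
  forall x y : X, x <> y ->
    exists! g : `[0, mdist x y]%classic -> X, geodesic g /\ joins g.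

Definition straight : Prop :=
  forall (u v : R) (g : `[u, v]%classic -> X), u < v -> geodesic g ->
    exists! f : R -> X, geodesic_line f /\ forall t, f (val t) = g t.

End geodesics.

Arguments proper_space {R} X.
Arguments uniquely_geodesic {R} X.
Arguments straight {R} X.

Section visual.
Context {R : realType}.

Definition nonneg : set R := [set t | 0 <= t].

Lemma nonneg0_subproof : (0 : R) \in nonneg.
Proof. by rewrite inE /nonneg /= lexx. Qed.

Definition nonneg0 : nonneg := exist _ 0 nonneg0_subproof.

Context {X : metricType R} (b : X).

Definition ray_set : set {family compact, nonneg -> X} :=
  [set g | geodesic (g : nonneg -> X) /\ g nonneg0 = b].

(* D_b, with the topology induced by compact convergence *)
Definition rays : Type := ray_set.

HB.instance Definition _ := Topological.copy rays ray_set.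

(* g(t) for t >= 0; only used for such t *)
Definition ray_at (g : rays) (t : R) : X := val g (insubd nonneg0 t).

Definition enonneg : set (\bar R) := [set r | (0 <= r)%E].

(* The union of X and D_b *)
Definition visual : Type := (X + rays)%type.

Definition visual_pt (x : X) : visual := inl x.
Definition visual_bd (g : rays) : visual := inr g.

Definition polar (p : rays * enonneg) : visual :=
  if val p.2 is r%:E then visual_pt (ray_at p.1 r) else visual_bd p.1.

HB.instance Definition _ := Choice.copy visual (X + rays)%type.

(* The quotient topology of D_b x [0, +oo] / (D_b x {0}), carried over to
   [visual] by the identifications (g, r) ~ g(r) for r < +oo and
   (g, +oo) ~ g *)
Definition visual_open : set_system visual :=
  [set U | open (polar @^-1` U)].

Lemma visual_openT : visual_open setT.
Proof. by rewrite /visual_open /= preimage_setT; exact: openT. Qed.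

Lemma visual_openI : setI_closed visual_open.
Proof. by move=> U V oU oV; exact: openI. Qed.

Lemma visual_open_bigU (I : Type) (U : I -> set visual) :
  (forall i, visual_open (U i)) -> visual_open (\bigcup_i U i).
Proof.
move=> oU; rewrite /visual_open /= preimage_bigcup.
by apply: bigcup_open => i _; exact: oU.
Qed.

HB.instance Definition _ :=
  isOpenTopological.Build visual visual_openT visual_openI visual_open_bigU.

End visual.

Arguments visual_pt {R X} b x.
Arguments visual_bd {R X} b g.

(* C(X), with the topology of compact convergence *)
Definition contfun {R : realType} (X : metricType R) : Type :=
  initial_topology
    (fun f : continuousType X R => (f : X -> R) : {family compact, X -> R}).

HB.instance Definition _ (R : realType) (X : metricType R) :=
  Topological.copy (contfun X)
    (initial_topology
      (fun f : continuousType X R => (f : X -> R) : {family compact, X -> R})).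

(* The value of an element of C(X) at a point *)
Definition cfun {R : realType} {X : metricType R} (f : contfun X) : X -> R :=
  (f : continuousType X R).

Section horofunction.
Context {R : realType} {X : metricType R} (b : X).

Definition hfun (x : X) : X -> R := fun y => mdist x y - mdist x b.

Lemma hfun_continuous x : continuous (hfun x).
Proof.
move=> y; apply/cvgrPdist_lt => e e0.
have := nbhsx_ballx y e e0; apply: filterS => z.
rewrite ballEmdist /= /hfun => yz.
rewrite opprB addrA subrK (le_lt_trans _ yz)// ler_norml lerBlDr lerBrDl.
apply/andP; split; last first.
  by rewrite (metric_sym y z) addrC metric_triangle.
by rewrite lerBlDl addrC metric_triangle.
Qed.

HB.instance Definition _ x := isContinuous.Build X R (hfun x)
  (@hfun_continuous x).

Definition hmap (x : X) : contfun X := (hfun x : continuousType X R).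

Definition horo_set : set (contfun X) := closure (range hmap).

Definition horo : Type := horo_set.

HB.instance Definition _ := Topological.copy horo horo_set.

Lemma hmap_horo x : hmap x \in horo_set.
Proof. by rewrite inE; apply: subset_closure; exists x. Qed.

Definition horo_pt (x : X) : horo := exist _ (hmap x) (hmap_horo x).

HB.instance Definition _ := isPointed.Build horo (horo_pt b).

Definition horo_boundary : set horo := ~` range horo_pt.

Definition horo_fun (xi : horo) : X -> R := cfun (val xi).

Definition busemann (p : visual b) : horo :=
  match p with
  | inl x => horo_pt x
  | inr g => lim (horo_pt (ray_at g t) @[t --> +oo])
  end.

Definition ray_represents (xi : horo) (g : rays b) : Prop :=
  exists f : R -> X, [/\ geodesic_line f,
    forall t, 0 <= t -> f t = ray_at g t &
    forall t, horo_fun xi (f t) - horo_fun xi (f 0) = - t].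

(* The default value of [xget] is irrelevant when X is proper, uniquely
   geodesic and straight: exactly one point then satisfies the condition. *)
Definition horo_proj (xi : horo) : visual b :=
  xget (visual_pt b b) [set p |
    match p with
    | inl x => xi = horo_pt x
    | inr g => horo_boundary xi /\ ray_represents xi g
    end].

End horofunction.

Arguments busemann {R X} b p.
Arguments horo_proj {R X} b xi.

(* Main.v *)
Require Import Defs.
From mathcomp Require Import all_boot all_order all_algebra.
From mathcomp Require Import all_classical all_reals all_analysis.
From mathcomp Require Import lra.

Set Implicit Arguments.
Unset Strict Implicit.
Unset Printing Implicit Defensive.

Import Order.TTheory GRing.Theory Num.Theory.
Import numFieldNormedType.Exports.

Local Open Scope classical_set_scope.
Local Open Scope ring_scope.

(** Every point xi of the horofunction compactification is 1-Lipschitz and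
    vanishes at b. It lies in the fiber over the ray gamma exactly when
    xi (f t) = - t along the line f that extends gamma ([horo_proj_bd]); the
    ray is determined by xi because two such lines glue, at b, to a geodesic
    line, which by straightness coincides with both.

    The fiber over gamma contains B(gamma), and B(gamma) is its greatest
    element: if xi lies in the fiber, then
      xi y <= xi (gamma t) + d(y, gamma t) = d(gamma t, y) - t,
    and the right-hand side decreases to B(gamma) y as t grows
    ([represents_le_busemann]).

    If B is continuous at gamma along the boundary, then B(gamma) is also the
    least element of the fiber. Write xi in the fiber as a limit of points
    h(x) along an ultrafilter. The points x escape to infinity, and the rays
    theta_x through them converge to a ray that represents xi, hence to gamma
    ([ray_represents_limit]). As x lies on theta_x, monotonicity along rays
    gives B(theta_x) <= h(x), and in the limit B(gamma) <= xi
    ([ray_represents_busemann_limit]).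

    Conversely let the fiber be a singleton, and let points with polar
    coordinates (theta, r) approach gamma, i.e. theta -> gamma and
    r -> +oo. By compactness their images under B accumulate only at points
    xi, and each of these is represented by the limit gamma of the rays theta
    ([ray_represents_limit] again), so xi = B(gamma) ([busemann_polar_cvg]).
    Continuity in polar coordinates is continuity on the quotient because
    polar coordinates are injective away from b ([open_polar_image]). Finally,
    the inclusion of the boundary is continuous, so continuity of B implies
    continuity of its restriction. *)

(** * Ultrafilters and compact convergence *)

Lemma fmap_ultra {T U : Type} (f : T -> U) (F : set_system T) :
  UltraFilter F -> UltraFilter (f @ F).
Proof.
move=> FU; split=> [|G GF FG]; first exact: fmap_proper_filter.
apply/seteqP; split=> // A GA.
have [//|FnA] := in_ultra_setVsetC (f @^-1` A) FU.
have /filter_ex[? []//] : G (A `&` ~` A) by apply: filterI => //; exact: FG.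
Qed.

Lemma compact_ultra_cvg {T : Type} {V : topologicalType} (F : set_system T)
    (K : set V) (u : T -> V) :
  UltraFilter F -> compact K -> (forall i, K (u i)) ->
  exists2 l, K l & u @ F --> l.
Proof.
rewrite compact_ultra => FU Kc Ku.
have [|l [Kl Fl]] := Kc _ (fmap_ultra u FU).
  exact: (@filterE _ F _ (u @^-1` K)).
by exists l.
Qed.

(** Continuity can be tested on ultrafilters: a neighbourhood of [f x] whose
    preimage is not a neighbourhood of [x] leaves room for an ultrafilter that
    converges to [x] and avoids this preimage. *)
Lemma continuous_at_ultra {T U : topologicalType} (f : T -> U) (x : T) :
  (forall G, UltraFilter G -> G --> x -> f @ G --> f x) ->
  f @ nbhs x --> f x.
Proof.
move=> fG A Afx; apply: contrapT => xA.
have : ProperFilter (within (~` (f @^-1` A)) (nbhs x)).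
  apply: Build_ProperFilter_ex => B; rewrite /within /= => xB.
  apply: contrapT => B0; apply: xA; apply: filterS xB => y yB.
  by apply: contrapT => Ay; apply: B0; exists y; exact: yB.
move=> /ultraFilterLemma[G [GU xG]].
have GA : G (f @^-1` A).
  by apply: fG Afx => // B xB; apply: xG; exact: filterS xB.
have GnA : G (~` (f @^-1` A)) by apply: xG; rewrite /within /=; exact: filterE.
by have /filter_ex[y []] : G (f @^-1` A `&` ~` (f @^-1` A)) by exact: filterI.
Qed.

(** Points of a closure are reached along an ultrafilter on the index type, so
    that every other quantity attached to the indices converges as soon as it
    stays in a compact set. *)
Lemma ultra_of_closure {T : Type} {U : topologicalType} (f : T -> U) (x : U) :
  closure (range f) x -> exists2 G, UltraFilter G & f @ G --> x.
Proof.
move=> xf.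
have : ProperFilter (filter_from (nbhs x) (fun A => f @^-1` A)).
  apply: filter_from_proper.
    apply: filter_from_filter; first by exists setT; exact: filterT.
    by move=> A B xA xB; exists (A `&` B) => //; exact: filterI.
  by move=> A /xf[_ [[t _ <-] At]]; exists t.
move=> /ultraFilterLemma[G [GU xG]]; exists G => // A xA.
by apply: xG; exists A.
Qed.

Lemma initial_cvg {I : Type} {S : choiceType} {T : topologicalType} (f : S -> T)
    (F : set_system I) (u : I -> S) (s : S) : Filter F ->
  (f \o u) @ F --> f s -> u @ F --> (s : initial_topology f).
Proof.
move=> FF fu A [_ [[B oB <-] /= Bs BA]].
apply: (@filterS _ _ _ (u @^-1` (f @^-1` B))); first by move=> i /BA.
by apply: fu; exact: open_nbhs_nbhs.
Qed.

(** The equicontinuous half of Arzela-Ascoli: on a compact set, finitely many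
    of the neighbourhoods that equicontinuity provides suffice. *)
Lemma equicontinuous_cvg_compact {R : realType} {I : Type} {Y : topologicalType}
    {Z : pseudoMetricType R} (F : set_system I) (u : I -> Y -> Z) (l : Y -> Z) :
  Filter F ->
  (forall y e, 0 < e -> \forall z \near y, forall i, ball (u i y) e (u i z)) ->
  continuous l ->
  (forall y, u i y @[i --> F] --> l y) ->
  u @ F --> (l : {family compact, Y -> Z}).
Proof.
move=> FF ueq lc ul; apply/fam_cvgP => K Kc P.
rewrite uniform_nbhs => -[E [+ EP]].
rewrite -entourage_ballE => -[e /= e0 eE].
suff : \forall i \near F, K `<=` [set y | ball (l y) e (u i y)].
  rewrite !near_simpl; apply: filterS => i iK; apply: EP => y Ky.
  by apply: (eE (l y, u i y)); exact: iK.
have e30 : 0 < e / 3 by rewrite divr_gt0.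
apply: (compact_near_coveringP K).1 => // y Ky.
near=> z i => /=.
have -> : e = e / 3 + e / 3 + e / 3 by lra.
apply: (@ball_triangle _ _ (u i y)).
  apply: (@ball_triangle _ _ (l y)).
    apply: ball_sym; near: z; have /cvg_ballP := lc y; exact.
  near: i; have /cvg_ballP := ul y; exact.
by move: (i); near: z; exact: ueq.
Unshelve. all: by end_near. Qed.

Lemma compact_cvg_pointwise {I : Type} {Y : topologicalType} {Z : uniformType}
    (F : set_system I) (u : I -> Y -> Z) (l : Y -> Z) (y : Y) : Filter F ->
  u @ F --> (l : {family compact, Y -> Z}) -> u i y @[i --> F] --> l y.
Proof.
move=> FF /fam_cvgP /(_ [set y] (@compact_set1 _ y)).
by rewrite uniform_set1.
Qed.

Lemma cvg_le {T : Type} {R : realType} (F : set_system T) (f g : T -> R)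
    (l m : R) {FF : ProperFilter F} :
  f @ F --> l -> g @ F --> m -> (\forall i \near F, f i <= g i) -> l <= m.
Proof.
move=> fl gm fg; rewrite -subr_ge0.
apply: (@closed_cvg _ _ F _ (g \- f) (fun x => 0 <= x)) => //.
- by apply: filterS fg => i; rewrite /= subr_ge0.
- exact: cvgB.
Qed.

Lemma cvg_mdist {T : Type} {R : realType} {X : metricType R}
   (F : set_system T) {FF : Filter F} (f g : T -> X) (l m : X) :
  f @ F --> l -> g @ F --> m -> mdist (f i) (g i) @[i --> F] --> mdist l m.
Proof.
move=> fl gm; apply/cvgrPdist_lt => e e0.
have e20 : 0 < e / 2 by rewrite divr_gt0.
near=> i.
have : mdist l (f i) < e / 2.
  by near: i; exact: metricType_numDomainType.cvgr_dist_lt.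
have : mdist m (g i) < e / 2.
  by near: i; exact: metricType_numDomainType.cvgr_dist_lt.
have := metric_triangle l (f i) m; have := metric_triangle (f i) (g i) m.
have := metric_triangle (f i) l (g i); have := metric_triangle l m (g i).
rewrite (metric_sym (g i) m) (metric_sym (f i) l) => *.
by rewrite ltr_norml; apply/andP; split; lra.
Unshelve. all: by end_near. Qed.

(** * Geodesic lines and rays *)

Section lines_and_rays.
Context {R : realType} {X : metricType R}.

Lemma geodesic_line_unique (f g : R -> X) (u v : R) :
  straight X -> geodesic_line f -> geodesic_line g -> u < v ->
  (forall t, u <= t <= v -> f t = g t) -> f = g.
Proof.
move=> sX fl gl uv fg.
have fuv : geodesic (fun t : `[u, v]%classic => f (val t)).
  by move=> s t; rewrite fl.
have [h [_ hu]] := sX u v _ uv fuv.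
rewrite -(hu f)//; apply: hu; split=> // t.
by rewrite fg//; have := set_valP t; rewrite /= in_itv.
Qed.

(** If the past of [f] and the future of [g] concatenate to a geodesic line,
    then straightness, applied on either side of the junction, identifies that
    line with both [f] and [g]. *)
Lemma geodesic_line_glue (f g : R -> X) (u : R) :
  straight X -> geodesic_line f -> geodesic_line g -> f u = g u ->
  (forall s t, s <= u -> u <= t -> mdist (f s) (g t) = t - s) -> f = g.
Proof.
move=> sX fl gl fgu fg.
pose h t := if t <= u then f t else g t.
have hl : geodesic_line h.
  suff H s t : s <= t -> mdist (h s) (h t) = t - s.
    move=> s t; have [st|/ltW ts] := leP s t.
      by rewrite H// ger0_norm// subr_ge0.
    by rewrite metric_sym H// distrC ger0_norm// subr_ge0.
  move=> st; rewrite /h; have [su|us] := leP s u; have [tu|ut] := leP t u.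
  - by rewrite fl ger0_norm// subr_ge0.
  - by rewrite fg// ltW.
  - by have := le_lt_trans st (le_lt_trans tu us); rewrite ltxx.
  - by rewrite gl ger0_norm// subr_ge0.
have -> : f = h.
  apply: (@geodesic_line_unique _ _ (u - 1) u) => //; first by lra.
  by move=> t /andP[_ tu]; rewrite /h tu.
apply: (@geodesic_line_unique _ _ u (u + 1)) => //; first by lra.
move=> t /andP[ut _]; rewrite /h; case: ifPn => // tu.
by have -> : t = u by apply/eqP; rewrite eq_le tu.
Qed.

Context {b : X}.
Implicit Types g h : rays b.

Lemma ray_at_val g (t : @nonneg R) : ray_at g (val t) = val g t.
Proof. by rewrite /ray_at valKd. Qed.

Lemma ray_at0 g : ray_at g 0 = b.
Proof.
have [_ gb] := set_valP g.
by rewrite -[0]/(val (@nonneg0 R)) ray_at_val.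
Qed.

Lemma mdist_ray_at g (s t : R) : 0 <= s -> 0 <= t ->
  mdist (ray_at g s) (ray_at g t) = `|t - s|.
Proof.
have [gg _] := set_valP g.
by move=> s0 t0; rewrite /ray_at gg !insubdK// inE.
Qed.

Lemma mdist_base_ray_at g (t : R) : 0 <= t -> mdist b (ray_at g t) = t.
Proof.
by move=> t0; rewrite -{1}(ray_at0 g) mdist_ray_at// subr0 ger0_norm.
Qed.

Lemma eq_ray_at g h : (forall t, 0 <= t -> ray_at g t = ray_at h t) -> g = h.
Proof.
move=> gh; apply: val_inj; apply/funext => t.
by rewrite -!ray_at_val gh//; have := set_valP t.
Qed.

Lemma ray_of_line (f : R -> X) : geodesic_line f -> f 0 = b ->
  exists g, forall t, 0 <= t -> ray_at g t = f t.
Proof.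
move=> fl fb.
have fr : ray_set b (fun t : @nonneg R => f (val t)).
  by split=> // s t; rewrite fl.
exists (exist (fun x => x \in ray_set b) _ (mem_set fr)) => t t0.
by rewrite /ray_at /= insubdK// inE.
Qed.

Hypotheses (uX : uniquely_geodesic X) (sX : straight X).

(** The lines that extend the initial segments of a ray all extend its unit
    segment, so they coincide and a single line contains the ray. *)
Lemma ray_line g : exists2 f : R -> X, geodesic_line f &
  forall t, 0 <= t -> f t = ray_at g t.
Proof.
have gg (u : R) : geodesic (fun t : `[0, u]%classic => ray_at g (val t)).
  move=> s t; apply: mdist_ray_at.
    by have := set_valP s; rewrite /= in_itv => /andP[].
  by have := set_valP t; rewrite /= in_itv => /andP[].
have gl (u : R) : 0 < u -> exists2 f, geodesic_line f &
    forall t, 0 <= t <= u -> f t = ray_at g t.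
  move=> u0; have [f [[fl fg] _]] := sX u0 (gg u).
  exists f => // t t0u; have tu : `[0, u]%classic t by rewrite /= in_itv.
  exact: (fg (SigSub (mem_set tu))).
have [f fl fg] := gl 1 ltr01; exists f => // t t0.
have [|h hl hg] := gl (1 + t); first by lra.
have -> : f = h.
  apply: (geodesic_line_unique sX fl hl ltr01) => s /andP[s0 s1].
  by rewrite fg ?s0// hg// s0/=; lra.
by rewrite hg// t0/=; lra.
Qed.

Lemma ray_through (x : X) : x <> b -> exists g, ray_at g (mdist x b) = x.
Proof.
move=> xb; have [g [[gg [g0 g1]] _]] := uX (nesym xb).
have d0 : 0 < mdist b x by rewrite mdist_gt0; apply/eqP/nesym.
have [f [[fl fg] _]] := sX d0 gg.
have i0 : `[0, mdist b x]%classic 0 by rewrite /= in_itv /= lexx ltW.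
have i1 : `[0, mdist b x]%classic (mdist b x) by rewrite /= in_itv /= lexx ltW.
have [|h hf] := ray_of_line fl.
  by have := fg (SigSub (mem_set i0)); rewrite /= => ->; exact: g0.
exists h; rewrite metric_sym hf ?ltW//.
by have := fg (SigSub (mem_set i1)); rewrite /= => ->; exact: g1.
Qed.

Lemma ray_unique g h (r : R) : 0 < r -> ray_at g r = ray_at h r -> g = h.
Proof.
move=> r0 gh.
pose x := ray_at g r.
have dx : mdist b x = r by rewrite mdist_base_ray_at// ltW.
have bx : b <> x.
  by move=> bx; move: dx r0; rewrite -bx mdistxx => <-; rewrite ltxx.
have [c [_ cu]] := uX bx.
have cE (k : rays b) : ray_at k r = x ->
    c = fun t : `[0, mdist b x]%classic => ray_at k (val t).
  move=> kx; apply: cu; split.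
    move=> s t; apply: mdist_ray_at.
      by have := set_valP s; rewrite /= in_itv => /andP[].
    by have := set_valP t; rewrite /= in_itv => /andP[].
  split=> t ->; first exact: ray_at0.
  by rewrite dx.
have [f fl fg] := ray_line g; have [k kl kh] := ray_line h.
apply: eq_ray_at => t t0; rewrite -fg// -kh//.
congr (_ t); apply: (geodesic_line_unique sX fl kl r0) => s s0r.
have sI : `[0, mdist b x]%classic s by rewrite dx /= in_itv.
have := cE g erefl; rewrite (cE h (esym gh)).
move=> /(congr1 (@^~ (SigSub (mem_set sI)))) /=.
have /andP[s0 _] := s0r.
by rewrite fg// kh.
Qed.

Lemma cvg_ray_at {T : Type} (F : set_system T) {FF : Filter F}
    (u : T -> rays b) g t :
  u @ F --> g -> ray_at (u i) t @[i --> F] --> ray_at g t.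
Proof.
move=> ug.
have ug' : (val \o u) @ F --> (val g : {family compact, @nonneg R -> X}).
  exact: (continuous_cvg _ (@initial_continuous _ _ _ g) ug).
exact: compact_cvg_pointwise ug'.
Qed.

(** Rays from b are isometries, hence equicontinuous. *)
Lemma rays_cvg {T : Type} (F : set_system T) (u : T -> rays b) g : Filter F ->
  (forall t, 0 <= t -> ray_at (u i) t @[i --> F] --> ray_at g t) -> u @ F --> g.
Proof.
move=> FF ug; apply: initial_cvg.
have near_ball (t : @nonneg R) (e : R) : 0 < e ->
    \forall s \near t, forall k : rays b, ball (val k t) e (val k s).
  have vt : (set_val s : R) @[s --> t] --> (set_val t : R).
    exact: initial_continuous.
  move=> e0.
  have := (@cvgrPdist_lt _ _ _ _ (nbhs_filter t) _ _).1 vt e e0.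
  apply: filterS => s ts k; rewrite ballEmdist /=.
  by have [kg _] := set_valP k; rewrite kg distrC.
apply: equicontinuous_cvg_compact => //.
- move=> t e e0; apply: (@filterS _ _ (nbhs_filter t)) (near_ball t e e0).
  by move=> s ts i; exact: ts.
- move=> t; apply: (@cvg_ballP _ _ _ _ (nbhs_filter t) _ _).2 => e e0.
  by apply: (@filterS _ _ (nbhs_filter t)) (near_ball t e e0) => s; exact.
- move=> t; have := ug (val t) (set_valP t).
  rewrite ray_at_val; apply: cvg_trans; apply: near_eq_cvg; apply: nearW => i.
  by rewrite ray_at_val.
Qed.

End lines_and_rays.

(** * The horofunction compactification *)

Section horofunctions.
Context {R : realType} {X : metricType R} {b : X}.
Implicit Types xi zeta : horo b.

Lemma cfun_cvg {T : Type} (F : set_system T) {FF : Filter F}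
    (u : T -> contfun X) l y :
  u @ F --> l -> cfun (u i) y @[i --> F] --> cfun l y.
Proof.
move=> ul.
apply: (@compact_cvg_pointwise _ _ _ F (fun i => cfun (u i)) (cfun l)).
exact: (continuous_cvg _ (@initial_continuous _ _ _ l) ul).
Qed.

Lemma horo_fun_cvg {T : Type} (F : set_system T) {FF : Filter F}
    (u : T -> horo b) xi y :
  u @ F --> xi -> horo_fun (u i) y @[i --> F] --> horo_fun xi y.
Proof.
move=> uxi; apply: (@cfun_cvg _ F _ (val \o u)).
exact: (continuous_cvg _ (@initial_continuous _ _ _ xi) uxi).
Qed.
Arguments horo_fun_cvg {T F FF u xi} y _.

Lemma horo_ultra xi : exists2 G, UltraFilter G & @horo_pt R X b @ G --> xi.
Proof.
have [G GU Gxi] := ultra_of_closure (set_valP xi).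
by exists G => //; exact: initial_cvg.
Qed.

Lemma horo_fun0 xi : horo_fun xi b = 0.
Proof.
have [G GU /(horo_fun_cvg b) Gb] := horo_ultra xi.
apply: (cvg_unique (@Rhausdorff R) Gb).
apply: cvg_near_cst; apply: nearW => x.
by rewrite /horo_fun /cfun /= /hfun subrr.
Qed.

Lemma horo_fun_lip xi y z : horo_fun xi y <= horo_fun xi z + mdist y z.
Proof.
have [G GU Gxi] := horo_ultra xi.
apply: (cvg_le (horo_fun_cvg y Gxi)
  (cvgD (horo_fun_cvg z Gxi) (cvg_cst (mdist y z)))).
apply: nearW => x.
rewrite -[(_ + _) x]/(_ x + mdist y z) /horo_fun /cfun /= /hfun.
by have := metric_triangle x z y; rewrite (metric_sym z y); lra.
Qed.

Lemma horo_fun_norm xi y z : `|horo_fun xi y - horo_fun xi z| <= mdist y z.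
Proof.
have := horo_fun_lip xi y z; have := horo_fun_lip xi z y.
by rewrite (metric_sym z y) ler_norml => *; apply/andP; split; lra.
Qed.

Lemma horo_fun_bounds xi y : - mdist b y <= horo_fun xi y <= mdist b y.
Proof.
by have := horo_fun_norm xi y b; rewrite horo_fun0 subr0 metric_sym ler_norml.
Qed.

Lemma eq_horo_fun xi zeta : horo_fun xi =1 horo_fun zeta -> xi = zeta.
Proof. by move=> h; apply: val_inj; apply/continuousEP. Qed.

Lemma near_mdist_lt (y : X) (e : R) : 0 < e -> \forall z \near y, mdist y z < e.
Proof. by move=> e0; have := nbhsx_ballx y e e0; rewrite ballEmdist. Qed.

(** Horofunctions are 1-Lipschitz, so their pointwise limits are continuous and
    are reached uniformly on compact sets. Convergence of horofunctions can
    therefore be treated pointwise throughout. *)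
Lemma compact_cvg_horo_fun {T : Type} (F : set_system T) (u : T -> horo b)
    (l : X -> R) : ProperFilter F ->
  (forall y, horo_fun (u i) y @[i --> F] --> l y) ->
  continuous l /\
  (fun i => horo_fun (u i)) @ F --> (l : {family compact, X -> R}).
Proof.
move=> FF ul.
(* The limit inherits the common Lipschitz bound. *)
have lc : continuous l.
  move=> y; apply/cvgrPdist_le => e e0.
  apply: filterS (near_mdist_lt y e0) => z yz.
  apply: (cvg_le (cvg_norm (cvgB (ul y) (ul z))) (cvg_cst e)).
  by apply: nearW => i; exact: le_trans (horo_fun_norm _ _ _) (ltW yz).
split=> //; apply: equicontinuous_cvg_compact => // y e e0.
apply: filterS (near_mdist_lt y e0) => z yz i.
exact: le_lt_trans (horo_fun_norm _ _ _) yz.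
Qed.

Lemma horo_cvg {T : Type} (F : set_system T) (u : T -> horo b) xi :
  ProperFilter F ->
  (forall y, horo_fun (u i) y @[i --> F] --> horo_fun xi y) -> u @ F --> xi.
Proof.
move=> FF uxi; apply: initial_cvg; apply: initial_cvg.
exact: (compact_cvg_horo_fun FF uxi).2.
Qed.

Lemma horo_cvg_ex {T : Type} (F : set_system T) (u : T -> horo b) :
  ProperFilter F ->
  (forall y, exists r : R, horo_fun (u i) y @[i --> F] --> r) ->
  exists xi, u @ F --> xi.
Proof.
move=> FF /choice[l ul].
have [lc ulc] := compact_cvg_horo_fun FF ul.
pose m : contfun X := (mkcts lc : continuousType X R).
have um : (val \o u) @ F --> m by exact: initial_cvg.
have mH : horo_set b m.
  apply: (closed_cvg (horo_set b) _ _ m um).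
    exact: closed_closure.
  by apply: nearW => i; exact: set_valP.
exists (SigSub (mem_set mH)); exact: initial_cvg.
Qed.

(** Compactness of the horofunction compactification: the values at y stay in
    the compact interval of radius d(b, y), so pointwise limits exist. *)
Lemma horo_ultra_cvg {T : Type} (G : set_system T) (u : T -> horo b) :
  UltraFilter G -> exists xi, u @ G --> xi.
Proof.
move=> GU; apply: horo_cvg_ex => y.
have [|r _ ur] := @compact_ultra_cvg _ R G `[- mdist b y, mdist b y]%classic
  (fun i => horo_fun (u i) y) GU (@segment_compact _ _ _).
  by move=> i; rewrite /= in_itv /=; exact: horo_fun_bounds.
by exists r.
Qed.

Lemma horo_hausdorff : hausdorff_space (horo b).
Proof.
move=> xi zeta xz; apply: eq_horo_fun => y.
apply: (@Rhausdorff R) => A B Axi Bzeta.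
have ev (k : horo b) : horo_fun z y @[z --> k] --> horo_fun k y.
  exact: (horo_fun_cvg (F := nbhs k) (FF := nbhs_filter k) (u := id) y).
have [k [Ak Bk]] := xz _ _ (ev xi _ Axi) (ev zeta _ Bzeta).
by exists (horo_fun k y).
Qed.

Implicit Types g : rays b.

Lemma horo_fun_ray_at g (t : R) y : 0 <= t ->
  horo_fun (horo_pt b (ray_at g t)) y = mdist (ray_at g t) y - t.
Proof.
move=> t0.
by rewrite /horo_fun /cfun /= /hfun (metric_sym _ b) mdist_base_ray_at.
Qed.

Lemma horo_fun_ray_at_noninc g (s t : R) y : 0 <= s <= t ->
  horo_fun (horo_pt b (ray_at g t)) y <= horo_fun (horo_pt b (ray_at g s)) y.
Proof.
move=> /andP[s0 st]; have t0 := le_trans s0 st.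
rewrite !horo_fun_ray_at//.
have := metric_triangle (ray_at g t) (ray_at g s) y.
rewrite mdist_ray_at// distrC ger0_norm ?subr_ge0//; lra.
Qed.

(** The limit that defines the Busemann map exists since
    d(g(t), y) - t is nonincreasing in t and bounded below. *)
Lemma busemann_ray_cvg g :
  horo_pt b (ray_at g t) @[t --> +oo] --> busemann b (visual_bd b g).
Proof.
rewrite /busemann /=.
suff [xi gxi] : exists xi, horo_pt b (ray_at g t) @[t --> +oo] --> xi.
  by rewrite (cvg_lim horo_hausdorff gxi).
apply: horo_cvg_ex => y.
pose v t := horo_fun (horo_pt b (ray_at g t)) y.
(* [ray_at g] follows the ray only for nonnegative times. *)
pose A := v @` [set t | 0 <= t].
have Ainf : has_inf A.
  split; first by exists (v 0), 0; rewrite /= ?lexx.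
  exists (- mdist b y) => _ [t _ <-].
  by have /andP[] := horo_fun_bounds (horo_pt b (ray_at g t)) y.
exists (inf A); apply/cvgrPdist_lt => e e0.
have [_ [s s0 <-] vs] := inf_adherent e0 Ainf.
near=> t.
have st : s <= t by near: t; apply: nbhs_pinfty_ge; exact: num_real.
have t0 : 0 <= t := le_trans s0 st.
have : inf A <= v t by apply: (ge_inf Ainf.2); exists t.
have : v t <= v s by apply: horo_fun_ray_at_noninc; rewrite s0.
by rewrite -/(v t) ltr_norml => *; apply/andP; split; lra.
Unshelve. all: by end_near. Qed.
Arguments busemann_ray_cvg : clear implicits.

Lemma horo_fun_busemann_cvg g y :
  horo_fun (horo_pt b (ray_at g t)) y @[t --> +oo] -->
  horo_fun (busemann b (visual_bd b g)) y.
Proof. exact: horo_fun_cvg (busemann_ray_cvg g). Qed.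
Arguments horo_fun_busemann_cvg : clear implicits.

Lemma horo_fun_busemann_le g (t : R) y : 0 <= t ->
  horo_fun (busemann b (visual_bd b g)) y <=
  horo_fun (horo_pt b (ray_at g t)) y.
Proof.
move=> t0.
have gB := horo_fun_busemann_cvg g y.
apply: (cvg_le gB (cvg_cst (horo_fun (horo_pt b (ray_at g t)) y))).
near=> s; apply: horo_fun_ray_at_noninc; rewrite t0 /=.
by near: s; apply: nbhs_pinfty_ge; exact: num_real.
Unshelve. all: by end_near. Qed.

End horofunctions.

(** * Rays that represent a horofunction *)

Section representing_rays.
Context {R : realType} {X : metricType R} {b : X}.
Implicit Types (xi : horo b) (g h : rays b).

(** The lines of [ray_represents], normalised by xi(b) = 0 and detached from the
    ray that they extend. *)
Definition gradient_line xi (f : R -> X) :=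
  geodesic_line f /\ forall t, horo_fun xi (f t) = - t.

Lemma ray_representsE xi g : ray_represents xi g <->
  exists2 f, gradient_line xi f & forall t, 0 <= t -> f t = ray_at g t.
Proof.
have f0 f : (forall t, 0 <= t -> f t = ray_at g t) -> horo_fun xi (f 0) = 0.
  by move=> fg; rewrite fg// ray_at0 horo_fun0.
split=> [[f [fl fg fxi]]|[f [fl fxi] fg]]; exists f => //.
  by split=> // t; rewrite -fxi f0// subr0.
by split=> // t; rewrite fxi f0// subr0.
Qed.

(** For s <= 0 <= t, the 1-Lipschitz function xi drops by t - s from k(s) to
    f(t), which forces d(k(s), f(t)) = t - s: the past of k and the future of f
    concatenate to a geodesic line. *)
Lemma gradient_line_unique xi (f k : R -> X) : straight X ->
  gradient_line xi f -> gradient_line xi k -> f 0 = b -> k 0 = b -> f = k.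
Proof.
move=> sX [fl fxi] [kl kxi] f0 k0.
apply/esym/(geodesic_line_glue (u := 0) sX kl fl) => [|s t s0 t0].
  by rewrite k0.
apply/eqP; rewrite eq_le; apply/andP; split.
  apply: le_trans (metric_triangle _ b _) _.
  rewrite -{1}k0 -f0 kl fl sub0r subr0 ger0_norm ?oppr_ge0// ger0_norm//; lra.
have := horo_fun_norm xi (k s) (f t); rewrite fxi kxi.
by apply: le_trans; apply: le_trans (ler_norm _); lra.
Qed.

Lemma ray_represents_unique xi g h : straight X ->
  ray_represents xi g -> ray_represents xi h -> g = h.
Proof.
move=> sX /ray_representsE[f fxi fg] /ray_representsE[k kxi kh].
apply: eq_ray_at => t t0; rewrite -fg// -kh//; congr (_ t).
by apply: (gradient_line_unique sX fxi kxi); rewrite ?fg ?kh// ray_at0.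
Qed.

(** A horofunction that is represented by a ray is unbounded below, while h(x)
    is bounded below by - d(x, b). *)
Lemma ray_represents_boundary xi g : ray_represents xi g -> horo_boundary xi.
Proof.
move=> /ray_representsE[f [_ fxi] _] [x _ xxi].
have := fxi (mdist x b + 1); rewrite -xxi /horo_fun /cfun /= /hfun.
by have := mdist_ge0 x (f (mdist x b + 1)); lra.
Qed.

Lemma horo_proj_bd xi g : straight X ->
  horo_proj b xi = visual_bd b g <-> ray_represents xi g.
Proof.
move=> sX; rewrite /horo_proj; split.
  by case: xgetP => // p _ + pg; rewrite pg => -[].
move=> xig; case: xgetP => [[x|h] _|/(_ (visual_bd b g))].
- by move=> xix; case: (ray_represents_boundary xig); exists x.
- by move=> [_ xih]; rewrite (ray_represents_unique sX xih xig).
- by case; split => //; exact: ray_represents_boundary xig.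
Qed.

(** A point with polar coordinates (theta, r) lies on the line extending theta,
    so the distance to it decreases with unit speed along that line up to time
    r. Letting r grow covers the boundary points, where r = +oo. *)
Lemma horo_fun_busemann_polar (p : rays b * @enonneg R) (f : R -> X) (t : R) :
  geodesic_line f -> (forall s, 0 <= s -> f s = ray_at p.1 s) ->
  (t%:E <= val p.2)%E -> horo_fun (busemann b (polar p)) (f t) = - t.
Proof.
case: p => g r /= fl fg.
have fpt (s : R) : 0 <= s -> t <= s ->
    horo_fun (horo_pt b (ray_at g s)) (f t) = - t.
  move=> s0 ts; rewrite horo_fun_ray_at// -fg// fl ler0_norm ?subr_le0//; lra.
rewrite /polar /=; have := set_valP r.
rewrite /enonneg /=; case: (val r) => [s| |] //.
  by rewrite !lee_fin; exact: fpt.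
move=> _ _.
have gB := @horo_fun_busemann_cvg _ _ _ g (f t).
apply: (cvg_unique (@Rhausdorff R) gB).
apply: cvg_near_cst; near=> s; apply: fpt; near: s;
  by apply: nbhs_pinfty_ge; exact: num_real.
Unshelve. all: by end_near. Qed.

Lemma enonneg_pinfty_subproof : @enonneg R +oo%E.
Proof. exact: le0y. Qed.

Definition enonneg_pinfty : @enonneg R :=
  SigSub (mem_set enonneg_pinfty_subproof).

Lemma polar_pinfty g : polar (g, enonneg_pinfty) = visual_bd b g.
Proof. by []. Qed.

Lemma busemann_represents g : straight X ->
  ray_represents (busemann b (visual_bd b g)) g.
Proof.
move=> sX; have [f fl fg] := ray_line sX g.
apply/ray_representsE; exists f => //; split => // t.
by rewrite -polar_pinfty; apply: horo_fun_busemann_polar => //=; exact: leey.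
Qed.

(** Since xi is 1-Lipschitz and xi(g(t)) = - t, its value at y is at most
    d(g(t), y) - t for every t. *)
Lemma represents_le_busemann xi g y : ray_represents xi g ->
  horo_fun xi y <= horo_fun (busemann b (visual_bd b g)) y.
Proof.
move=> /ray_representsE[f [fl fxi] fg].
have gB := @horo_fun_busemann_cvg _ _ _ g y.
apply: (cvg_le (cvg_cst (horo_fun xi y)) gB).
near=> t.
have t0 : 0 <= t by near: t; apply: nbhs_pinfty_ge; exact: num_real.
rewrite horo_fun_ray_at// -fg//.
by have := horo_fun_lip xi y (f t); rewrite fxi (metric_sym y); lra.
Unshelve. all: by end_near. Qed.

Lemma geodesic_line_limit {T : Type} (G : set_system T) (f : T -> R -> X) :
  proper_space X -> UltraFilter G ->
  (forall i, geodesic_line (f i)) -> (forall i, f i 0 = b) ->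
  exists2 l, geodesic_line l & forall t, f i t @[i --> G] --> l t.
Proof.
move=> pX GU fl f0.
have lex t : exists x : X, f i t @[i --> G] --> x.
  have [|x _ fx] := @compact_ultra_cvg _ _ G _ (fun i => f i t) GU (pX b `|t|).
    by move=> i; rewrite /= -(f0 i) fl subr0.
  by exists x.
have [l fl_l] := choice lex; exists l => // s t.
apply: (cvg_unique (@Rhausdorff R) (cvg_mdist (fl_l s) (fl_l t))).
by apply: cvg_near_cst; apply: nearW => i; rewrite fl.
Qed.

(** By the Lipschitz bound, u_i(f_i(t)) = - t passes to the limit: being
    represented by a ray is a closed condition. The hypothesis on [u] is only
    asymptotic, so it applies both to Busemann functions and to points of X
    that go to infinity. The lines, and not only the rays, have to converge,
    which properness grants. *)
Lemma ray_represents_limit {T : Type} (G : set_system T) (f : T -> R -> X)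
    (u : T -> horo b) xi g :
  proper_space X -> UltraFilter G ->
  (forall i, geodesic_line (f i)) -> (forall i, f i 0 = b) ->
  (forall t, 0 <= t -> f i t @[i --> G] --> ray_at g t) ->
  (forall t, \forall i \near G, horo_fun (u i) (f i t) = - t) ->
  u @ G --> xi -> ray_represents xi g.
Proof.
move=> pX GU fl f0 fg fu uxi.
have [l ll fl_l] := geodesic_line_limit pX GU fl f0.
apply/ray_representsE; exists l; last first.
  move=> t t0; apply: (cvg_unique (@metric_hausdorff _ X) (fl_l t)).
  exact: fg.
split=> // t.
apply: (cvg_unique (@Rhausdorff R) (horo_fun_cvg (y := l t) uxi)).
apply/cvgrPdist_lt => e e0; near=> i.
have -> : - t = horo_fun (u i) (f i t).
  by near: i; apply: filterS (fu t) => i ->.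
apply: le_lt_trans (horo_fun_norm _ _ _) _; rewrite metric_sym.
by near: i; apply: metricType_numDomainType.cvgr_dist_lt.
Unshelve. all: by end_near. Qed.

(** If the points x stayed in a bounded set, they would accumulate at some x0 by
    properness, and xi would be h(x0). *)
Lemma horo_boundary_escapes xi (G : set_system X) (M : R) :
  proper_space X -> UltraFilter G -> horo_pt b @ G --> xi ->
  horo_boundary xi -> \forall x \near G, M < mdist x b.
Proof.
move=> pX GU Gxi bxi.
have [GM|] := in_ultra_setVsetC [set x | mdist b x <= M] GU; last first.
  by apply: filterS => x /= /negP; rewrite -ltNge metric_sym.
have := pX b M; rewrite compact_ultra => /(_ _ GU GM)[x0 [_ Gx0]].
case: bxi; exists x0 => //.
apply: (cvg_unique (@horo_hausdorff _ _ _) _ Gxi).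
have GF : ProperFilter G by exact: ultra_proper.
apply: horo_cvg => y; apply: cvgB; apply: cvg_mdist => //; exact: cvg_cst.
Qed.

End representing_rays.

(** * Polar coordinates near the boundary *)

Section topology_of_visual.
Context {R : realType} {X : metricType R} {b : X}.

Lemma polar_continuous : continuous (@polar R X b).
Proof. by apply/continuousP. Qed.

Lemma visual_bd_continuous : continuous (visual_bd b).
Proof.
move=> g.
apply: (@continuous_comp _ _ _ (fun g => (g, enonneg_pinfty)) (@polar R X b)).
  move=> A [[W V] [/= Wg Vy] WVA]; apply: filterS Wg => h Wh.
  by apply: (WVA (h, enonneg_pinfty)); split=> //=; exact: nbhs_singleton.
exact: polar_continuous.
Qed.

Lemma polar_inj (p q : rays b * @enonneg R) :
  uniquely_geodesic X -> straight X -> (0 < val p.2)%E ->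
  polar p = polar q -> p = q.
Proof.
move=> uX sX; case: p q => [g r] [h s] /=.
have rs (r' s' : R) : 0 < r' -> 0 <= s' ->
    ray_at g r' = ray_at h s' -> r' = s' /\ g = h.
  move=> r0 s0 gh; have rs : r' = s'.
    by have := mdist_base_ray_at g (ltW r0); rewrite gh mdist_base_ray_at.
  by split=> //; apply: (ray_unique uX sX r0); rewrite gh rs.
have := set_valP s; have := set_valP r; rewrite /polar /enonneg /=.
case Er : (val r) => [r'| |]; case Es : (val s) => [s'| |] //=.
  rewrite !lee_fin lte_fin => _ s0 r0 [/(rs _ _ r0 s0)[rs' ->]].
  by congr pair; apply: val_inj; rewrite Er Es rs'.
by move=> _ _ _ [->]; congr pair; apply: val_inj; rewrite Er Es.
Qed.

Lemma nbhs_enonneg_pinfty (V : set (@enonneg R)) : nbhs enonneg_pinfty V ->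
  exists2 M : R, 0 <= M & forall r, (M%:E < val r)%E -> V r.
Proof.
move=> [_ [[B oB <-] /= By BV]].
have [M [Mr MB]] : nbhs +oo%E B by exact: open_nbhs_nbhs.
(* [M] may be negative, while [polar] is injective only at positive radii. *)
exists (Num.max M 0); first by rewrite le_max lexx orbT.
move=> r Mr'; apply: BV; apply: MB; apply: le_lt_trans Mr'.
by rewrite lee_fin le_max lexx.
Qed.

(** Away from b, saturated open sets of polar coordinates descend to the
    quotient; since [polar] is injective there, every product of open sets is
    saturated. *)
Lemma open_polar_image (W : set (rays b)) (M : R) :
  uniquely_geodesic X -> straight X -> open W -> 0 <= M ->
  open (@polar R X b @` [set p | W p.1 /\ (M%:E < val p.2)%E]).
Proof.
move=> uX sX oW M0; rewrite /open /= /visual_open /=.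
have -> : @polar R X b @^-1`
      (@polar R X b @` [set p | W p.1 /\ (M%:E < val p.2)%E]) =
    fst @^-1` W `&` snd @^-1` (val @^-1` [set r | (M%:E < r)%E]).
  apply/seteqP; split=> [p [q [Wq Mq] qp]|p [Wp Mp]]; last by exists p.
  have <- : q = p; last by [].
  by apply: polar_inj => //; apply: le_lt_trans Mq; rewrite lee_fin.
apply: openI.
  by apply: open_comp => // p _; exact: cvg_fst.
apply: open_comp => [p _|]; last exact: open_ereal_gt_ereal.
apply: (continuous_comp (f := snd)); first exact: cvg_snd.
exact: initial_continuous.
Qed.

End topology_of_visual.

(** * Continuity of the Busemann map at a ray *)

Section busemann_continuity.
Context {R : realType} {X : metricType R} {b : X}.
Hypotheses (pX : proper_space X) (uX : uniquely_geodesic X) (sX : straight X).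
Variable g : rays b.

(** B(g) <= xi: approximate xi by h(x), and h(x) from below by the Busemann
    function of the ray through x, to which continuity at g applies. *)
Lemma ray_represents_busemann_limit xi :
  {for g, continuous (busemann b \o visual_bd b)} ->
  ray_represents xi g -> xi = busemann b (visual_bd b g).
Proof.
move=> Bc xig; have bxi := ray_represents_boundary xig.
have [G GU Gxi] := horo_ultra xi.
have escape M := horo_boundary_escapes M pX GU Gxi bxi.
(* For x = b no ray is singled out, but x = b is excluded eventually. *)
have /choice[th thx] (x : X) :
    exists h : rays b, x <> b -> ray_at h (mdist x b) = x.
  have [->|/eqP xb] := eqVneq x b; first by exists g.
  by have [h hx] := ray_through uX sX xb; exists h.
have /choice[f fP] (x : X) : exists f : R -> X, geodesic_line f /\
    forall t, 0 <= t -> f t = ray_at (th x) t.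
  by have [f fl fh] := ray_line sX (th x); exists f.
have f0 x : f x 0 = b by rewrite (fP x).2// ray_at0.
have [l ll fl] := geodesic_line_limit pX GU (fun x => (fP x).1) f0.
have l0 : l 0 = b.
  apply: (cvg_unique (@metric_hausdorff _ X) (fl 0)).
  by apply: cvg_near_cst; apply: nearW.
have [h hl] := ray_of_line ll l0.
have xih : ray_represents xi h.
  apply: (ray_represents_limit pX GU (fun x => (fP x).1) f0 _ _ Gxi).
    by move=> t t0; rewrite hl.
  move=> t; apply: filterS (escape (Num.max t 0)) => x.
  rewrite gt_max => /andP[tx x0].
  have xb : x <> b by move=> xb; rewrite xb mdistxx ltxx in x0.
  rewrite -{1}(thx x xb) horo_fun_ray_at ?ltW// -(fP x).2 ?ltW//.
  by rewrite (fP x).1 ler0_norm ?subr_le0 ?ltW//; lra.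
have thg : th @ G --> g.
  rewrite (ray_represents_unique sX xig xih); apply: rays_cvg => t t0.
  rewrite hl//; apply: cvg_trans (fl t); apply: near_eq_cvg.
  by apply: nearW => x; rewrite (fP x).2.
have Bth : (busemann b \o visual_bd b \o th) @ G --> busemann b (visual_bd b g).
  by apply: cvg_comp thg _; exact: Bc.
apply: eq_horo_fun => y; apply/eqP; rewrite eq_le represents_le_busemann//=.
apply: (cvg_le (horo_fun_cvg (y := y) Bth) (horo_fun_cvg (y := y) Gxi)).
apply: filterS (escape 0) => x x0.
have xb : x <> b by move=> xb; rewrite xb mdistxx ltxx in x0.
by rewrite -{2}(thx x xb); apply: horo_fun_busemann_le; exact: ltW.
Qed.

(** By compactness it is enough to identify the limits of B along ultrafilters
    that converge to g in polar coordinates; g represents all of them. *)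
Lemma busemann_polar_cvg :
  (forall xi, ray_represents xi g -> xi = busemann b (visual_bd b g)) ->
  busemann b (polar p) @[p --> (g, enonneg_pinfty)] -->
    busemann b (visual_bd b g).
Proof.
move=> gB; rewrite -polar_pinfty.
apply: (@continuous_at_ultra _ _ (busemann b \o @polar R X b)).
move=> G GU Gg /=.
have [xi Gxi] := horo_ultra_cvg (busemann b \o @polar R X b) GU.
suff xiB : xi = busemann b (visual_bd b g) by rewrite xiB in Gxi.
apply: gB.
have G1 : fst @ G --> g by apply: (cvg_trans (cvg_app _ Gg)); exact: cvg_fst.
have G2 : snd @ G --> (enonneg_pinfty : @enonneg R).
  by apply: (cvg_trans (cvg_app _ Gg)); exact: cvg_snd.
have /choice[f fP] (p : rays b * @enonneg R) : exists f : R -> X,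
    geodesic_line f /\ forall t, 0 <= t -> f t = ray_at p.1 t.
  by have [f fl fh] := ray_line sX p.1; exists f.
apply: (ray_represents_limit pX GU (fun p => (fP p).1) _ _ _ Gxi).
- by move=> p; rewrite (fP p).2// ray_at0.
- move=> t t0; apply: cvg_trans (cvg_ray_at (t := t) G1); apply: near_eq_cvg.
  by apply: nearW => p; rewrite (fP p).2.
- move=> t.
  have : nbhs (enonneg_pinfty : @enonneg R) (val @^-1` [set r | (t%:E < r)%E]).
    apply: open_nbhs_nbhs; split; last by rewrite /= ltry.
    by exists [set r | (t%:E < r)%E] => //; exact: open_ereal_gt_ereal.
  move=> /G2 Gt; have : G [set p | (t%:E < val p.2)%E] by exact: Gt.
  apply: filterS => p /ltW tp.
  exact: horo_fun_busemann_polar (fP p).1 (fP p).2 tp.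
Qed.

Lemma busemann_continuous_bd :
  busemann b (polar p) @[p --> (g, enonneg_pinfty)] -->
    busemann b (visual_bd b g) ->
  {for visual_bd b g, continuous (busemann b)}.
Proof.
move=> Bp A /Bp [[W V] [/= Wg /nbhs_enonneg_pinfty[M M0 MV] WVA]].
have : nbhs (visual_bd b g)
    (@polar R X b @` [set p | interior W p.1 /\ (M%:E < val p.2)%E]).
  apply: open_nbhs_nbhs; split.
    exact: open_polar_image (@open_interior _ W) M0.
  by exists (g, enonneg_pinfty) => //; split=> //=; rewrite ltry.
apply: filterS => _ [p [Wp Mp] <-].
by apply: (WVA p); split; [exact: interior_subset|exact: MV].
Qed.

End busemann_continuity.

Theorem proposition1p4 (R : realType) (X : metricType R) (b : X)
    (gamma : rays b) :
  proper_space X -> uniquely_geodesic X -> straight X ->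
  [<-> {for gamma, continuous (busemann b \o visual_bd b)};
       exists xi : horo b,
         horo_proj b @^-1` [set visual_bd b gamma] = [set xi];
       {for visual_bd b gamma, continuous (busemann b)}].
Proof.
move=> pX uX sX; tfae.
- move=> Bc; exists (busemann b (visual_bd b gamma)).
  apply/seteqP; split=> xi /=; rewrite horo_proj_bd//.
    exact: ray_represents_busemann_limit.
  by move=> ->; exact: busemann_represents.
- move=> [zeta Pzeta].
  apply: busemann_continuous_bd => //; apply: busemann_polar_cvg => //.
  have fib xi : ray_represents xi gamma -> xi = zeta.
    move=> /(horo_proj_bd _ _ sX) xig.
    by have : [set zeta] xi by rewrite -Pzeta.
  by move=> xi /fib ->; apply/esym/fib; exact: busemann_represents.
- by move=> Bc; apply: continuous_comp; [exact: visual_bd_continuous|exact: Bc].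
Qed.
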